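(* Let $R=\{(2,2),(2,3),(3,2),(3,3)\}$. Then $(123,R)\sim_d(132,R)$.
   Context: $S_n$ denotes the set of permutations of $[n]=\{1,\dots,n\}$, written $\pi=\pi_1\cdots\pi_n$. A mesh pattern of length $k$ is a pair $(\tau,R)$ with $\tau\in S_k$ and $R\subseteq\{0,1,\dots,k\}^2$ (the shaded boxes; box $(a,b)$ is the unit square $[a,a+1]\times[b,b+1]$ in the diagram of $\tau$). An occurrence of $(\tau,R)$ in $\pi\in S_n$ is a choice of indices $i_1<\dots<i_k$ such that $\pi_{i_1}\cdots\pi_{i_k}$ is order-isomorphic to $\tau$ and, with $i_0=0$, $i_{k+1}=n+1$, $v_1<\dots<v_k$ the values $\pi_{i_1},\dots,\pi_{i_k}$ sorted increasingly, $v_0=0$, $v_{k+1}=n+1$, for every $(a,b)\in R$ there is no index $m$ with $i_a<m<i_{a+1}$ and $v_b<\pi_m<v_{b+1}$. Mesh patterns $p,q$ are equidistributed, $p\sim_d q$, if for all $n,\ell\ge0$ the number of $\pi\in S_n$ with exactly $\ell$ occurrences of $p$ equals the number with exactly $\ell$ occurrences of $q$. *)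

(* Defs.v *)
From mathcomp Require Import all_boot all_order all_fingroup.

Set Implicit Arguments.
Unset Strict Implicit.
Unset Printing Implicit Defensive.

(* S_n is 'S_n, the permutations of 'I_n = {0, ..., n-1}: the index i and the
   value pi_i of the 1-based convention are (j : nat).+1 and (pi j : nat).+1,
   for the ordinal j with j.+1 = i. *)

(* (tau, R); the ordinal pair (a, b) is the box [a, a+1] x [b, b+1]. *)
Definition mesh_pattern (k : nat) : Type :=
  ('S_k * {set 'I_k.+1 * 'I_k.+1})%type.

Section Occurrences.
Variables (k n : nat) (p : mesh_pattern k) (pi : 'S_n).

(* An index selection i_1 < ... < i_k is a strictly increasing function
   'I_k -> 'I_n. *)
Implicit Type f : {ffun 'I_k -> 'I_n}.

(* [:: i_0; i_1; ...; i_k; i_(k+1)], with i_0 = 0 and i_(k+1) = n+1. *)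
Definition index_lines f : seq nat :=
  0 :: rcons [seq (f a : nat).+1 | a <- enum 'I_k] n.+1.

(* [:: v_0; v_1; ...; v_k; v_(k+1)], with v_0 = 0 and v_(k+1) = n+1. *)
Definition value_lines f : seq nat :=
  0 :: rcons (sort leq [seq (pi (f a) : nat).+1 | a <- enum 'I_k]) n.+1.

Definition increasing f : bool :=
  [forall a : 'I_k, forall b : 'I_k, (a < b) ==> (f a < f b)].

Definition order_isomorphic f : bool :=
  [forall a : 'I_k, forall b : 'I_k,
    (pi (f a) < pi (f b)) == (p.1 a < p.1 b)].

Definition in_box f (a b : nat) (m : 'I_n) : bool :=
  (nth 0 (index_lines f) a < m.+1 < nth 0 (index_lines f) a.+1)
  && (nth 0 (value_lines f) b < (pi m : nat).+1 < nth 0 (value_lines f) b.+1).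

Definition occurrence f : bool :=
  [&& increasing f, order_isomorphic f &
      [forall ab in p.2, ~~ [exists m : 'I_n, in_box f ab.1 ab.2 m]]].

Definition occurrences : nat := #|[set f | occurrence f]|.

End Occurrences.

Definition equidistributed (k k' : nat)
    (p : mesh_pattern k) (q : mesh_pattern k') : Prop :=
  forall n l : nat,
    #|[set pi : 'S_n | occurrences p pi == l]|
    = #|[set pi : 'S_n | occurrences q pi == l]|.

Notation "p ~d q" := (equidistributed p q) (at level 70, no associativity).

Definition perm123 : 'S_3 := 1%g.
Definition perm132 : 'S_3 := tperm (inord 1) (inord 2).

Fact perm123E : [seq (perm123 i : nat).+1 | i <- enum 'I_3] = [:: 1; 2; 3].
Proof.
rewrite (eq_map (g := fun i : 'I_3 => (val i).+1)); last first.
  by move=> i; rewrite perm1.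
by rewrite (map_comp S val) val_enum_ord.
Qed.

Fact perm132E : [seq (perm132 i : nat).+1 | i <- enum 'I_3] = [:: 1; 3; 2].
Proof.
rewrite (eq_map (g := fun i : 'I_3 => nth 0 [:: 1; 3; 2] (val i))).
  by rewrite (map_comp (nth 0 [:: 1; 3; 2]) val) val_enum_ord.
case=> [[|[|[|//]]] lt_i3]; rewrite permE /= -!val_eqE /= !inordK //=.
Qed.

Definition box (a b : nat) : 'I_4 * 'I_4 := (inord a, inord b).

Definition R_shading : {set 'I_4 * 'I_4} :=
  [set box 2 2; box 2 3; box 3 2; box 3 3].

(* Main.v *)
(* Read a permutation from left to right and let x < y be the two largest
   entries not read yet. An occurrence of (123, R) with middle entry pi_j exists
   only if pi_j = x, and then their number is the number of earlier entries below
   x. An occurrence of (132, R) with middle entry pi_j exists only if pi_j = y,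
   and then their number is again the number of earlier entries below x. Reading
   x instead of y changes only which of the two remains as the largest unread
   entry, and the later counts do not depend on the largest unread entry. So
   exchanging the roles of x and y at every step at which one of them is read
   carries one statistic to the other. *)
Require Import Defs.
From mathcomp Require Import all_boot all_order all_fingroup.
From mathcomp Require Import zify.

Set Implicit Arguments.
Unset Strict Implicit.
Unset Printing Implicit Defensive.

(** * Exchanging two letters of a word *)

Definition swap (x y b : nat) : nat :=
  if b == x then y else if b == y then x else b.

Lemma swapK x y : involutive (swap x y).
Proof. by rewrite /swap => b; do ! case: eqP => //; congruence. Qed.

Lemma swapR x y : swap x y y = x.
Proof. by rewrite /swap eqxx; case: eqP. Qed.

Lemma swapL x y : swap x y x = y.
Proof. by rewrite /swap eqxx. Qed.

Lemma swap_id x y b : b != x -> b != y -> swap x y b = b.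
Proof. by rewrite /swap => /negPf-> /negPf->. Qed.

Lemma map_swap_id x y s : x \notin s -> y \notin s -> map (swap x y) s = s.
Proof.
move=> xs ys; rewrite -[RHS]map_id; apply/eq_in_map => b bs.
by apply: swap_id; [apply: contraNneq xs => <- | apply: contraNneq ys => <-].
Qed.

Lemma perm_map_swap x y s : uniq s -> x \in s -> y \in s ->
  perm_eq (map (swap x y) s) s.
Proof.
move=> us xs ys.
have um : uniq (map (swap x y) s) by rewrite map_inj_uniq //; apply: inv_inj (swapK x y).
apply: uniq_perm => // b; rewrite -[b in LHS](swapK x y) mem_map; last exact: inv_inj (swapK x y).
by rewrite /swap; do ! case: eqP => [->|_]; rewrite ?xs ?ys.
Qed.

(** * The largest letter of a word *)

Definition seqmax (s : seq nat) := \max_(b <- s) b.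

Lemma leq_seqmax s b : b \in s -> b <= seqmax s.
Proof. by move=> bs; rewrite /seqmax; apply: leq_bigmax_seq. Qed.

Lemma seqmax_mem s : s != [::] -> seqmax s \in s.
Proof.
elim: s => [//|a [|b s] IH] _; first by rewrite /seqmax big_seq1 inE.
rewrite /seqmax big_cons in_cons /maxn; case: ifP => // _; first by rewrite orbC IH.
by rewrite eqxx.
Qed.

Lemma seqmaxE s m : m \in s -> (forall b, b \in s -> b <= m) -> seqmax s = m.
Proof.
move=> ms h; apply/eqP; rewrite eqn_leq leq_seqmax // andbT h //.
by apply: seqmax_mem; case: s ms {h}.
Qed.

(** * Suffix statistics on words and the exchange map [phi] *)

Fixpoint stat (g : nat -> seq nat -> nat) (s : seq nat) : nat :=
  if s is a :: t then g a t + stat g t else 0.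

(* The number of entries below the second largest of [a :: t] among those that
   precede [a] in a permutation of [0, n[: all smaller values but the
   [(size t).-1] smaller ones in [a :: t]. *)
Definition weight123 (a : nat) (t : seq nat) : nat :=
  if count (ltn a) t == 1 then a - (size t).-1 else 0.

(** The count is the same as for [weight123], but taken when [a] is the largest letter of [a :: t]:
    the second largest is then [seqmax t], and the other [(size t).-1] letters of [t] lie below
    it. *)
Definition weight132 (a : nat) (t : seq nat) : nat :=
  if (t != [::]) && all (gtn a) t then seqmax t - (size t).-1 else 0.

Definition toptwo (a : nat) (t : seq nat) : bool :=
  (t != [::]) && (count (ltn a) t <= 1).

(** The exchange is applied after the recursive call, so it relabels the whole image of the tail:
    [a] takes there the place of [seqmax t], which has become the first letter. *)
Fixpoint phi (s : seq nat) : seq nat :=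
  if s is a :: t then
    if toptwo a t then map (swap a (seqmax t)) (a :: phi t) else a :: phi t
  else [::].

Lemma phi_cons_top a t : toptwo a t ->
  phi (a :: t) = seqmax t :: map (swap a (seqmax t)) (phi t).
Proof. by rewrite /= => ->; rewrite swapL. Qed.

Lemma phi_cons_low a t : ~~ toptwo a t -> phi (a :: t) = a :: phi t.
Proof. by rewrite /= => /negPf->. Qed.

Lemma perm_phi s : uniq s -> perm_eq (phi s) s.
Proof.
elim: s => [//|a t IH] /= /andP[at_ ut].
have pt : perm_eq (a :: phi t) (a :: t) by rewrite perm_cons IH.
case: ifP => // /andP[tn0 _]; apply: perm_trans (pt).
change (perm_eq (map (swap a (seqmax t)) (a :: phi t)) (a :: phi t)).
apply: perm_map_swap; first by rewrite (perm_uniq pt) /= at_.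
  exact: mem_head.
by rewrite (perm_mem pt) inE seqmax_mem ?orbT.
Qed.

Lemma count_gtn_max a s : (forall b, b \in s -> b <= a) -> count (ltn a) s = 0.
Proof.
move=> h; apply/eqP; rewrite -leqn0 leqNgt -has_count; apply/hasPn => b /h.
by rewrite /= -leqNgt.
Qed.

(** If [b] were above [a], then [b] and [seqmax t] would be two letters of [t] above [a], against
    [toptwo]. *)
Lemma toptwo_lt a t b : uniq (a :: t) -> toptwo a t -> b \in t -> b != seqmax t ->
  b < a /\ b < seqmax t.
Proof.
move=> /= /andP[at_ ut] /andP[tn0 ct] bt bM.
have bltM : b < seqmax t by rewrite ltn_neqAle bM leq_seqmax.
split=> //; rewrite ltnNge; apply/negP => ab.
have {}ab : a < b by rewrite ltn_neqAle ab andbT; apply: contraNneq at_ => ->.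
have : size [:: b; seqmax t] <= size (filter (ltn a) t).
  apply: uniq_leq_size; first by rewrite /= inE bM.
  move=> c; rewrite !inE mem_filter => /orP[] /eqP->; rewrite /= ?ab //.
  by rewrite seqmax_mem // (ltn_trans ab).
by rewrite size_filter /= => /leq_trans/(_ ct).
Qed.

(* [weight132] only looks at the values of a suffix other than its largest one. *)
Lemma stat132_swap_max a M s : uniq s ->
  (forall b, b \in s -> b != M -> b < a /\ b < M) ->
  stat weight132 (map (swap a M) s) = stat weight132 s.
Proof.
elim: s => [//|b s IH] /= /andP[bs us] h.
have hs c : c \in s -> c != M -> c < a /\ c < M.
  by move=> cs; apply: h; rewrite inE cs orbT.
rewrite IH //; congr (_ + _); case: (boolP (M \in s)) => Ms.
  (* A larger letter follows [b] both before the exchange, namely [M], and after it, namely [a];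
     both weights are therefore 0. *)
  have bM : b != M by apply: contraNneq bs => ->.
  have [ba bltM] := h b (mem_head _ _) bM.
  have L c r : M \in r -> ~~ (M < c) -> weight132 c r = 0.
    move=> Mr cM; rewrite /weight132.
    by case: allP => [/(_ _ Mr)/=|]; rewrite ?andbF // (negPf cM).
  rewrite [RHS]L -?leqNgt 1?ltnW // /weight132 swap_id ?ltn_eqF //.
  case: allP => [/(_ a)|]; rewrite ?andbF //=.
  by rewrite -{1}(swapR a M) map_f // => /(_ isT); rewrite ltnNge ltnW.
case: (eqVneq b M) => [->|bM].
  have as_ : a \notin s.
    apply/negP => a_s; have [] := hs a a_s; last by rewrite ltnn.
    by apply: contraNneq Ms => <-.
  rewrite swapR map_swap_id // /weight132.
  have -> : all (gtn a) s.
    by apply/allP => c cs; apply: (hs c cs _).1; apply: contraNneq Ms => <-.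
  have -> // : all (gtn M) s.
  by apply/allP => c cs; apply: (hs c cs _).2; apply: contraNneq Ms => <-.
have [ba bltM] := h b (mem_head _ _) bM.
rewrite swap_id ?ltn_eqF // map_swap_id //.
apply/negP => a_s; have [] := hs a a_s; last by rewrite ltnn.
by apply: contraNneq Ms => <-.
Qed.

(** The weights agree letter by letter. In the exchanged case the image starts with [seqmax t] and
    the largest letter of its tail is [a], so both weights are [a - (size t).-1] if [a < seqmax t]
    and 0 otherwise. *)
Lemma stat_phi s : uniq s -> stat weight132 (phi s) = stat weight123 s.
Proof.
elim: s => [//|a t IH] us; have /andP[at_ ut] := us.
have pt := perm_phi ut.
have tN : (t != [::]) = (phi t != [::]) by rewrite -!size_eq0 (perm_size pt).
case: (boolP (toptwo a t)) => top2; last first.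
  (* Either [t] is empty or at least two of its letters exceed [a]; both weights are 0. *)
  rewrite phi_cons_low //= IH //; congr (_ + _).
  rewrite /weight132 /weight123 -tN (perm_all _ pt).
  move: top2; rewrite negb_and negbK; case: eqP => [->//|_] /= c2.
  rewrite eqn_leq (negPf c2) /=; case: allP => // h.
  by move: c2; rewrite count_gtn_max // => b /h /=; apply: ltnW.
have low := toptwo_lt us top2.
have tn0 : t != [::] by case/andP: top2.
rewrite phi_cons_top //=; congr (_ + _); last first.
  rewrite stat132_swap_max ?(perm_uniq pt) ?IH // => b.
  by rewrite (perm_mem pt); apply: low.
have Mt := seqmax_mem tn0.
have aM : a != seqmax t by apply: contraNneq at_ => ->.
have aphi : a \in map (swap a (seqmax t)) (phi t).
  by rewrite -{1}(swapR a (seqmax t)) map_f ?(perm_mem pt).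
have le_a b : b \in map (swap a (seqmax t)) (phi t) -> b <= a.
  case/mapP => c; rewrite (perm_mem pt) => ct ->.
  case: (eqVneq c (seqmax t)) => [->|cM]; first by rewrite swapR.
  rewrite swap_id ?(ltnW (low _ _ _).1) //.
  by apply: contraNneq at_ => <-.
rewrite /weight132 (seqmaxE aphi) // size_map (perm_size pt) /weight123.
have -> /= : [seq swap a (seqmax t) i | i <- phi t] != [::] by case: (map _ _) aphi.
case: (ltngtP a (seqmax t)) aM => // cmp _.
  have -> : all (gtn (seqmax t)) [seq swap a (seqmax t) i | i <- phi t].
    by apply/allP => b /le_a /= /leq_ltn_trans; apply.
  have c0 : 0 < count (ltn a) t.
    by rewrite -has_count; apply/hasP; exists (seqmax t).
  by case/andP: top2 => _ c1; rewrite eqn_leq c1 c0.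
case: allP => [/(_ _ aphi) /=|_]; first by rewrite ltnNge ltnW.
by rewrite count_gtn_max // => b /leq_seqmax /leq_trans; apply; apply: ltnW.
Qed.

(** * Bijectivity of [phi] and equidistribution on words *)

Lemma phi_head a b t u : uniq (a :: t) -> perm_eq (a :: t) (b :: u) ->
  head 0 (phi (a :: t)) = head 0 (phi (b :: u)) -> a = b.
Proof.
(* If [seqmax r] were [d], only [c] could exceed [d] in the common set of letters, whereas a
   nonempty [v] that fails [toptwo] has two letters above [d]. *)
have mixed c d r v : perm_eq (c :: r) (d :: v) ->
    toptwo c r -> ~~ toptwo d v -> seqmax r <> d.
  move=> p /andP[rn0 _]; rewrite negb_and negbK => /orP[/eqP v0|].
    by have := perm_size p; rewrite v0 /=; case: r rn0 {p}.
  rewrite -ltnNge => c2 rd; have := seq.permP p (ltn d).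
  by rewrite /= (@count_gtn_max d r) ?ltnn => [|x]; [lia | rewrite -rd; apply: leq_seqmax].
move=> us p; have us' : uniq (b :: u) by rewrite -(perm_uniq p).
case: (boolP (toptwo a t)) => ta; case: (boolP (toptwo b u)) => tb.
(* If [a] and [b] differ, each lies in the other tail and is not the common maximum of the tails, so
   [toptwo_lt] gives both [b < a] and [a < b]. *)
- rewrite !phi_cons_top //= => eqM; apply/eqP; apply/negPn/negP => ab.
  have au : a \in u by have := perm_mem p a; rewrite !inE eqxx (negPf ab).
  have bt : b \in t by have := perm_mem p b; rewrite !inE eqxx eq_sym (negPf ab).
  have notM c r : uniq (c :: r) -> toptwo c r -> c != seqmax r.
    by move=> /andP[cr _] /andP[rn0 _]; apply: contraNneq cr => ->; apply: seqmax_mem.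
  have [] := toptwo_lt us ta bt; first by rewrite eqM notM.
  have [] := toptwo_lt us' tb au; first by rewrite -eqM notM.
  lia.
- by rewrite phi_cons_top // phi_cons_low //= => /(mixed _ _ _ _ p ta tb).
- by rewrite phi_cons_low // phi_cons_top //= => /esym; rewrite perm_sym in p; move/(mixed _ _ _ _ p tb ta).
- by rewrite !phi_cons_low.
Qed.

(** Once the heads agree, the tails have the same letters, hence the same [toptwo] test and the same
    maximum; the same involution is then cancelled on both sides. *)
Lemma phi_inj s1 s2 : uniq s1 -> perm_eq s1 s2 -> phi s1 = phi s2 -> s1 = s2.
Proof.
elim: s1 s2 => [|a t IH] [|b u] //; first by move=> _ /perm_size.
  by move=> _ /perm_size.
move=> us p e; have ab : a = b by apply: phi_head us p _; rewrite e.
subst b; have {}p : perm_eq t u by rewrite -(perm_cons a).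
congr (_ :: _); apply: IH => //; first by case/andP: us.
have tE : toptwo a t = toptwo a u.
  by rewrite /toptwo -!size_eq0 (perm_size p) (seq.permP p).
have ME : seqmax t = seqmax u by rewrite /seqmax (perm_big _ p).
move: e; rewrite /= tE ME; case: ifP => _ [] //.
exact: (inj_map (inv_inj (swapK _ _))).
Qed.

Lemma count_stat_permutations V l : uniq V ->
  count (fun s => stat weight123 s == l) (permutations V) =
  count (fun s => stat weight132 s == l) (permutations V).
Proof.
move=> uV; have uP := permutations_uniq V.
have uphi : uniq (map phi (permutations V)).
  rewrite map_inj_in_uniq // => s1 s2; rewrite !mem_permutations => p1 p2.
  apply: phi_inj; first by rewrite (perm_uniq p1).
  by rewrite (perm_trans p1) // perm_sym.
have sub : {subset map phi (permutations V) <= permutations V}.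
  move=> s /mapP[r]; rewrite !mem_permutations => pr ->.
  by apply: perm_trans (perm_phi _) (pr); rewrite (perm_uniq pr).
(* An injective map of a finite list of words into itself is onto. *)
have [|_ mem] := uniq_min_size uphi sub; first by rewrite size_map.
rewrite [RHS](seq.permP (uniq_perm uP uphi (fsym mem))) count_map; apply: eq_in_count => s; rewrite mem_permutations /= => ps.
by have <- := stat_phi (etrans (perm_uniq ps) uV).
Qed.

(** * Permutations as words on the letters 0 to n - 1 *)

Lemma count_enum (T : finType) (P : pred T) :
  count P (enum T) = #|[set x | P x]|.
Proof. by rewrite -sum1_count big_enum_cond sum1dep_card. Qed.

Definition word n (pi : 'S_n) : seq nat := [seq val (pi i) | i <- enum 'I_n].

Lemma size_word n (pi : 'S_n) : size (word pi) = n.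
Proof. by rewrite size_map size_enum_ord. Qed.

Lemma nth_word n (pi : 'S_n) (i : 'I_n) : nth 0 (word pi) i = pi i.
Proof. by rewrite (nth_map i) ?size_enum_ord // nth_ord_enum. Qed.

Lemma word_inj n : injective (@word n).
Proof.
by move=> p q e; apply/permP => i; apply: val_inj; rewrite /= -!nth_word e.
Qed.

Lemma perm_word n (pi : 'S_n) : perm_eq (word pi) (iota 0 n).
Proof.
have ui : injective (fun i => val (pi i)) by apply: inj_comp val_inj perm_inj.
apply: uniq_perm; first by rewrite (map_inj_uniq ui) enum_uniq.
  exact: iota_uniq.
move=> b; rewrite mem_iota; apply/mapP/idP => [[i _ ->]|bn]; first by rewrite add0n ltn_ord.
by exists ((pi^-1)%g (Ordinal bn)); rewrite ?mem_enum // permKV.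
Qed.

Lemma card_perms_word n (P : pred (seq nat)) :
  #|[set pi : 'S_n | P (word pi)]| = count P (permutations (iota 0 n)).
Proof.
have uw : uniq (map (@word n) (enum 'S_n)).
  by rewrite map_inj_uniq ?enum_uniq //; apply: word_inj.
have up := permutations_uniq (iota 0 n).
have sub : {subset map (@word n) (enum 'S_n) <= permutations (iota 0 n)}.
  by move=> s /mapP[pi _ ->]; rewrite mem_permutations perm_word.
have [|_ mem] := uniq_min_size uw sub.
  (* Both lists have n! elements, so the injection [word] reaches every rearrangement. *)
  by rewrite size_permutations ?iota_uniq // size_iota size_map -cardE card_Sn.
rewrite -(seq.permP (uniq_perm uw up mem)) count_map count_enum.
by apply: eq_card => pi; rewrite !inE.
Qed.

Lemma stat_sum g s :
  stat g s = \sum_(j < size s) g (nth 0 s j) (drop j.+1 s).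
Proof.
by elim: s => [|a s IH] /=; rewrite ?big_ord0 // big_ord_recl /= drop0 IH.
Qed.

Lemma drop_word n (pi : 'S_n) (j : 'I_n) :
  drop j.+1 (word pi) = [seq val (pi m) | m : 'I_n <- enum 'I_n & j < m].
Proof.
rewrite -map_drop; congr map; apply: (inj_map val_inj).
rewrite map_drop val_enum_ord -(filter_map val (fun m => j < m)) val_enum_ord.
move: (nat_of_ord j) (ltn_ord j) => {}j jn; rewrite -(subnKC jn) iotaD add0n filter_cat drop_size_cat ?size_iota //.
rewrite (_ : filter _ (iota 0 _) = [::]) ?cat0s; last first.
  apply/eqP; rewrite -[_ == _]negbK -has_filter; apply/hasPn => m.
  by rewrite mem_iota /= -leqNgt.
by apply/esym/all_filterP/allP => m; rewrite mem_iota => /andP[].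
Qed.

Lemma count_drop_word n (pi : 'S_n) (j : 'I_n) P :
  count P (drop j.+1 (word pi)) = #|[set m : 'I_n | (j < m) && P (pi m)]|.
Proof.
rewrite drop_word count_map count_filter count_enum.
by apply: eq_card => m; rewrite !inE /= andbC.
Qed.

Lemma mem_drop_word n (pi : 'S_n) (j : 'I_n) (b : nat) :
  reflect (exists2 m : 'I_n, j < m & b = pi m) (b \in drop j.+1 (word pi)).
Proof.
rewrite drop_word; apply: (iffP mapP) => [[m]|[m jm ->]]; last first.
  by exists m => //; rewrite mem_filter jm mem_enum.
by rewrite mem_filter => /andP[jm _] ->; exists m.
Qed.

(* Exactly one entry to the right of [j] reaches the height [v], so that the
   other [n - j - 2] entries there are all below [v]. *)
Lemma card_below_left n (pi : 'S_n) (j k : 'I_n) (v : nat) :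
  v <= pi j -> j < k -> v <= pi k ->
  (forall m : 'I_n, j < m -> v <= pi m -> m = k) ->
  #|[set i : 'I_n | (i < j) && (pi i < v)]| = v - (size (drop j.+1 (word pi))).-1.
Proof.
move=> vj jk vk uk.
have tot : count (gtn v) (word pi) = v.
  rewrite (seq.permP (perm_word pi)) -size_filter.
  have vn : v <= n by apply: leq_trans vj (ltnW (ltn_ord _)).
  by rewrite (filter_iota_ltn 0 vn) size_iota.
have cr : count (gtn v) (drop j.+1 (word pi)) = (size (drop j.+1 (word pi))).-1.
  rewrite -(count_predC (gtn v) (drop j.+1 (word pi))).
  rewrite [X in _ + X](_ : _ = 1) ?addn1 // count_drop_word.
  apply: (@eq_card1 _ k) => m; rewrite !inE /= -leqNgt.
  by apply/andP/eqP => [[jm vm]|->]; [apply: uk | ].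
(* Positions are split at [j]; position [j] itself does not count, since [v <= pi j]. *)
have cl : count (gtn v) (word pi) =
    #|[set i : 'I_n | (i < j) && (pi i < v)]| + count (gtn v) (drop j.+1 (word pi)).
  rewrite count_drop_word -cardsUI [X in _ + X](_ : _ = 0) ?addn0.
    rewrite /word count_map count_enum; apply: eq_card => m; rewrite !inE /=.
    by case: (ltngtP m j) => [_|_|/ord_inj ->] /=; rewrite ?orbF // ltnNge vj.
  by apply/eqP; rewrite cards_eq0; apply/eqP/setP => m; rewrite !inE; case: (ltngtP m j); rewrite ?andbF.
by rewrite tot cr in cl; rewrite {2}cl addnK.
Qed.

(** * Index triples and the shape of an occurrence *)

Definition triple n (i j k : 'I_n) : {ffun 'I_3 -> 'I_n} :=
  [ffun a : 'I_3 => nth i [:: i; j; k] a].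

(** The middle index is summed outermost, to match the sum over positions in [stat_sum]. *)
Lemma card_triple n (P : pred {ffun 'I_3 -> 'I_n}) :
  #|[set f | P f]| =
  \sum_(j < n) #|[set ik : 'I_n * 'I_n | P (triple ik.1 j ik.2)]|.
Proof.
rewrite -sum1dep_card.
rewrite (reindex (fun t : 'I_n * ('I_n * 'I_n) => triple t.2.1 t.1 t.2.2)) /=.
  rewrite -(pair_big_dep xpredT (fun j ik => P (triple ik.1 j ik.2)) (fun _ _ => 1)).
  by apply: eq_bigr => j _; rewrite sum1dep_card.
exists (fun f : {ffun 'I_3 -> 'I_n} => (f (inord 1), (f (inord 0), f (inord 2)))).
  by move=> [j [i k]] _; rewrite !ffunE !inordK.
move=> f _; apply/ffunP => -[[|[|[|//]]] lt3]; rewrite ffunE /=; congr (f _);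
  by apply: val_inj; rewrite /= inordK.
Qed.

Lemma map_triple T n (F : 'I_n -> T) (i j k : 'I_n) :
  [seq F (triple i j k a) | a <- enum 'I_3] = [:: F i; F j; F k].
Proof. by rewrite !enum_ordSl enum_ord0 /= !ffunE. Qed.

Lemma forall_ord3 (P : pred 'I_3) :
  [forall a, P a] = [&& P ord0, P (lift ord0 ord0) & P (lift ord0 (lift ord0 ord0))].
Proof.
rewrite (_ : [forall a, P a] = all P (enum 'I_3)).
  by rewrite !enum_ordSl enum_ord0 /= andbT.
by apply/forallP/allP => h a; last apply: h; rewrite ?mem_enum.
Qed.

Lemma increasing_triple n (i j k : 'I_n) :
  increasing (triple i j k) = (i < j) && (j < k).
Proof.
rewrite /increasing !forall_ord3 !ffunE /= /bump /=; lia.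
Qed.

Lemma order_isomorphic123 n (pi : 'S_n) (i j k : 'I_n) :
  order_isomorphic (perm123, R_shading) pi (triple i j k) =
  (pi i < pi j) && (pi j < pi k).
Proof.
rewrite /order_isomorphic !forall_ord3 !ffunE /perm123 !perm1 /= /bump /=; lia.
Qed.

Lemma perm132_val (a : 'I_3) : perm132 a = nth 0 [:: 0; 2; 1] a :> nat.
Proof.
by case: a => [[|[|[|//]]] lt3]; rewrite permE /= -!val_eqE /= !inordK.
Qed.

Lemma order_isomorphic132 n (pi : 'S_n) (i j k : 'I_n) :
  order_isomorphic (perm132, R_shading) pi (triple i j k) =
  (pi i < pi k) && (pi k < pi j).
Proof.
rewrite /order_isomorphic !forall_ord3 !ffunE /= !perm132_val /= /bump /=; lia.
Qed.

Lemma R_shadingP n (pi : 'S_n) (f : {ffun 'I_3 -> 'I_n}) :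
  reflect (forall a b m, a \in [:: 2; 3] -> b \in [:: 2; 3] -> ~~ in_box pi f a b m)
    [forall ab in R_shading, ~~ [exists m : 'I_n, in_box pi f ab.1 ab.2 m]].
Proof.
apply: (iffP forall_inP) => h.
  move=> a b m a23 b23; have := h (box a b).
  have -> : box a b \in R_shading.
    move: a23 b23; rewrite !inE.
    by move=> /orP[] /eqP-> /orP[] /eqP->; rewrite eqxx ?orbT.
  move=> /(_ isT) /existsPn/(_ m); rewrite /= !inordK //.
    by move: b23; rewrite !inE => /orP[] /eqP->.
  by move: a23; rewrite !inE => /orP[] /eqP->.
move=> ab; rewrite !inE => abR; apply/existsPn => m; apply: h;
  by case/orP: abR => [/orP[/orP[]|]|] /eqP->; rewrite /= inordK.
Qed.

(** The four boxes fill the quadrant to the right of [j] and above the middle value, except for the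
    two grid lines inside it: column [k] and the height [w] of the largest value. Here [u], [v], [w]
    are values counted from 1, so [v <= pi m] means strictly above the middle value. *)
Lemma R_shading_triple n (pi : 'S_n) (i j k : 'I_n) u v w :
  j < k ->
  sort leq [seq (pi (triple i j k a)).+1 | a <- enum 'I_3] = [:: u; v; w] ->
  reflect (forall m : 'I_n, j < m -> v <= pi m -> m != k -> (pi m).+1 = w)
    [forall ab in R_shading,
      ~~ [exists m : 'I_n, in_box pi (triple i j k) ab.1 ab.2 m]].
Proof.
move=> jk sE.
have bE a b m : in_box pi (triple i j k) a b m =
    (nth 0 [:: 0; i.+1; j.+1; k.+1; n.+1] a < m.+1
      < nth 0 [:: 0; i.+1; j.+1; k.+1; n.+1] a.+1) &&
    (nth 0 [:: 0; u; v; w; n.+1] b < (pi m).+1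
      < nth 0 [:: 0; u; v; w; n.+1] b.+1).
  by rewrite /in_box /index_lines /value_lines sE (map_triple (fun x => x.+1)).
have vw : v <= w.
  by have := sort_sorted leq_total [seq (pi (triple i j k a)).+1 | a <- enum 'I_3];
    rewrite sE /= => /and3P[].
apply: (iffP (R_shadingP _ _)) => h.
  move=> m jm vm mk; have {}mk : m != k :> nat by [].
  have := h 2 2 m; have := h 2 3 m; have := h 3 2 m; have := h 3 3 m.
  rewrite !bE /= !inE /=; have := ltn_ord m; have := ltn_ord (pi m).
  by move=> ? ? /(_ isT isT) ? /(_ isT isT) ? /(_ isT isT) ? /(_ isT isT) ?; lia.
move=> a b m; rewrite bE !inE => /orP[] /eqP-> /orP[] /eqP-> /=; apply/negP => bm;
  have := h m; (case: (eqVneq m k) => [mk|_]; first by move: bm; rewrite mk; lia); lia.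
Qed.

Lemma occurrence123 n (pi : 'S_n) (i j k : 'I_n) :
  occurrence (perm123, R_shading) pi (triple i j k) =
  ((i < j) && (pi i < pi j)) &&
  [&& j < k, pi j < pi k &
    [forall m : 'I_n, (j < m) && (pi j < pi m) ==> (m == k)]].
Proof.
rewrite /occurrence increasing_triple order_isomorphic123 /=.
case: (ltnP i j) => //= ij; case: (ltnP j k) => //= jk; last by rewrite andbF.
case: (ltnP (pi i) (pi j)) => //= pij; case: (ltnP (pi j) (pi k)) => //= pjk.
have sE : sort leq [seq (pi (triple i j k a)).+1 | a <- enum 'I_3] =
    [:: (pi i).+1; (pi j).+1; (pi k).+1].
  rewrite (map_triple (fun x => (pi x).+1)) sorted_sort //=; first exact: leq_trans.
  lia.
apply/(R_shading_triple jk sE)/forallP => h m.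
  apply/implyP => /andP[jm pjm]; apply/negPn/negP => mk.
  (* The height [w] is that of [pi k], so the second grid line contains only the point [k]. *)
  have [/ord_inj/perm_inj mk'] := h m jm pjm mk.
  by rewrite mk' eqxx in mk.
by move=> jm pjm mk; have /implyP := h m; rewrite jm pjm (negPf mk) => /(_ isT).
Qed.

(** The height [w] is now that of [pi j], which no position after [j] attains, so [pi k] is the
    maximum to the right of [j]. As for 123, the conditions on [k] that do not involve [i] are
    grouped last. *)
Lemma occurrence132 n (pi : 'S_n) (i j k : 'I_n) :
  occurrence (perm132, R_shading) pi (triple i j k) =
  ((i < j) && (pi i < pi k)) &&
  [&& j < k, pi k < pi j &
    [forall m : 'I_n, (j < m) && (pi k < pi m) ==> (m == k)]].
Proof.
rewrite /occurrence increasing_triple order_isomorphic132 /=.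
case: (ltnP i j) => //= ij; case: (ltnP j k) => //= jk; last by rewrite andbF.
case: (ltnP (pi i) (pi k)) => //= pij; case: (ltnP (pi k) (pi j)) => //= pjk.
have sE : sort leq [seq (pi (triple i j k a)).+1 | a <- enum 'I_3] =
    [:: (pi i).+1; (pi k).+1; (pi j).+1].
  rewrite (map_triple (fun x => (pi x).+1)).
  rewrite (perm_sortP leq_total leq_trans anti_leq [:: _; _; _]
    [:: (pi i).+1; (pi k).+1; (pi j).+1] _); last first.
    by rewrite perm_cons (perm_catC [:: _] [:: _]).
  rewrite sorted_sort //=; first exact: leq_trans.
  lia.
apply/(R_shading_triple jk sE)/forallP => h m.
  apply/implyP => /andP[jm pjm]; apply/negPn/negP => mk.
  have [/ord_inj/perm_inj mj] := h m jm pjm mk.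
  by rewrite mj ltnn in jm.
by move=> jm pjm mk; have /implyP := h m; rewrite jm pjm (negPf mk) => /(_ isT).
Qed.

(** * Counting the occurrences with a given middle index *)

Lemma card_pairs_unique (T : finType) (P : T -> T -> bool) (Q : pred T) (k : T) :
  Q k -> (forall k', Q k' -> k' = k) ->
  #|[set ik : T * T | P ik.1 ik.2 && Q ik.2]| = #|[set i | P i k]|.
Proof.
move=> Qk uk; rewrite -[RHS](card_imset _ (_ : injective (fun i => (i, k)))); last by move=> x y [].
apply: eq_card => -[i k']; rewrite !inE /=; apply/andP/imsetP => [[Pik /uk ek]|[i' + [-> ->]]].
  by exists i; rewrite ?inE -?ek.
by rewrite inE.
Qed.

Lemma card_pairs_none (T : finType) (P : T -> T -> bool) (Q : pred T) :
  (forall k, ~~ Q k) -> #|[set ik : T * T | P ik.1 ik.2 && Q ik.2]| = 0.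
Proof.
move=> nQ; apply/eqP; rewrite cards_eq0; apply/eqP/setP => -[i k].
by rewrite !inE /= (negPf (nQ k)) andbF.
Qed.

Lemma weight123_word n (pi : 'S_n) (j : 'I_n) :
  #|[set ik : 'I_n * 'I_n | occurrence (perm123, R_shading) pi (triple ik.1 j ik.2)]| =
  weight123 (pi j) (drop j.+1 (word pi)).
Proof.
under eq_finset => ik do rewrite occurrence123.
rewrite /weight123 count_drop_word.
pose P (i k : 'I_n) := (i < j) && (pi i < pi j).
pose Q (k : 'I_n) := [&& j < k, pi j < pi k &
    [forall m : 'I_n, (j < m) && (pi j < pi m) ==> (m == k)]].
case: ifP => [/cards1P[k sE] | nE].
  have kP (m : 'I_n) : (j < m) && (pi j < pi m) = (m == k).
    by have /setP/(_ m) := sE; rewrite !inE.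
  have /andP[jk pjk] := etrans (kP k) (eqxx k).
  rewrite (@card_pairs_unique _ P Q k); first last.
  - by move=> k' /and3P[jk' pjk' _]; apply/eqP; rewrite -kP jk'.
  - by rewrite /Q jk pjk; apply/forallP => m; rewrite kP implybb.
  (* The level is [pi j]: to the right of [j] it is never met with equality, and it is exceeded only
     at [k]. *)
  apply: (card_below_left (k := k)) => //; first exact: ltnW.
  move=> m jm; rewrite leq_eqVlt => /orP[/eqP/ord_inj/perm_inj mj|pjm].
    by rewrite mj ltnn in jm.
  by apply/eqP; rewrite -kP jm.
apply: (@card_pairs_none _ P Q) => k; apply/negP => /and3P[jk pjk /forallP uk].
move/negP: nE; apply; apply/cards1P; exists k; apply/setP => m; rewrite !inE.
by apply/idP/eqP => [jm|->]; [apply/eqP; have /implyP := uk m; apply | rewrite jk].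
Qed.

Lemma weight132_word n (pi : 'S_n) (j : 'I_n) :
  #|[set ik : 'I_n * 'I_n | occurrence (perm132, R_shading) pi (triple ik.1 j ik.2)]| =
  weight132 (pi j) (drop j.+1 (word pi)).
Proof.
under eq_finset => ik do rewrite occurrence132.
rewrite /weight132.
pose P (i k : 'I_n) := (i < j) && (pi i < pi k).
pose Q (k : 'I_n) := [&& j < k, pi k < pi j &
    [forall m : 'I_n, (j < m) && (pi k < pi m) ==> (m == k)]].
have maxQ k : Q k -> forall m : 'I_n, j < m -> pi m <= pi k.
  move=> /and3P[_ _ /forallP uk] m jm; rewrite leqNgt; apply/negP => km.
  by have /implyP := uk m; rewrite jm km => /(_ isT)/eqP mk; rewrite mk ltnn in km.
have jword (m : 'I_n) : j < m -> val (pi m) \in drop j.+1 (word pi).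
  by move=> jm; apply/mem_drop_word; exists m.
case: ifP => [/andP[sN /allP below] | nE].
  have /mem_drop_word[k jk kE] := seqmax_mem sN.
  have Qk : Q k.
    have pkj : pi k < pi j := below _ (jword k jk).
    rewrite /Q jk pkj; apply/forallP => m; apply/implyP => /andP[jm].
    by rewrite ltnNge -kE leq_seqmax ?jword.
  rewrite (@card_pairs_unique _ P Q k) // ?kE.
    (* The level is [pi k], which as the maximum to the right of [j] is reached there only by
       [k]. *)
    apply: (card_below_left (k := k)) => //; first by case/and3P: Qk => _ /ltnW.
    by move=> m jm km; apply/(@perm_inj _ pi)/ord_inj/eqP; rewrite eqn_leq km (maxQ k Qk).
  move=> k' Qk'; apply/(@perm_inj _ pi)/ord_inj/eqP; rewrite eqn_leq (maxQ k Qk) ?(maxQ k' Qk') //.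
  by case/and3P: Qk'.
apply: (@card_pairs_none _ P Q) => k; apply/negP => Qk; have /and3P[jk pkj _] := Qk.
move/negP: nE; apply; apply/andP; split; first by case: (drop _ _) (jword k jk).
apply/allP => b /mem_drop_word[m jm ->] /=.
exact: leq_ltn_trans (maxQ k Qk m jm) pkj.
Qed.

Lemma occurrences_stat n (tau : 'S_3) g (pi : 'S_n) :
  (forall j : 'I_n,
    #|[set ik : 'I_n * 'I_n | occurrence (tau, R_shading) pi (triple ik.1 j ik.2)]| =
    g (pi j : nat) (drop j.+1 (word pi))) ->
  occurrences (tau, R_shading) pi = stat g (word pi).
Proof.
move=> gE; rewrite /occurrences card_triple stat_sum size_word.
by apply: eq_bigr => j _; rewrite gE nth_word.
Qed.

Theorem theorem4p4 :
  ((perm123, R_shading) : mesh_pattern 3) ~d ((perm132, R_shading) : mesh_pattern 3).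
Proof.
move=> n l.
under eq_finset => pi do rewrite (occurrences_stat (weight123_word pi)).
under [in RHS]eq_finset => pi do rewrite (occurrences_stat (weight132_word pi)).
rewrite (card_perms_word n (fun s => stat weight123 s == l)).
rewrite (card_perms_word n (fun s => stat weight132 s == l)).
exact: count_stat_permutations (iota_uniq 0 n).
Qed.
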